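(* Let $X$ be a smooth Banach space over $\mathbb{C}$ and let $T\in B(X)$ be such that both $T-c(T)I$ and $T^2-c(T)^2I$ are strongly normal. Then the following are equivalent: (i) $T$ attains its minimum modulus; (ii) $T$ attains its Crawford number; (iii) $\mu(T)$ is an eigenvalue of $T$.
   Context: $B(X)$ is the space of bounded linear operators on $X$, $S_X=\{x\in X:\|x\|=1\}$, $X^*$ is the space of bounded linear functionals on $X$. $X$ is smooth if every $x\in S_X$ admits a unique $x^*\in S_{X^*}$ with $x^*(x)=1$. The duality mapping $J:X\to X^*$ of a smooth Banach space assigns to each $x$ the unique functional $J(x)$ with $\|J(x)\|=\|x\|$ and $J(x)(x)=\|x\|^2$. For $T\in B(X)$ the transpose $T':X^*\to X^*$ is $(T'f)(x)=f(Tx)$. $T\in B(X)$ is self-adjoint if $T'\circ J=J\circ T$; $T$ is strongly normal if $T=S^2$ for some self-adjoint $S\in B(X)$. The minimum modulus is $\mu(T)=\inf\{\|Tx\|:x\in S_X\}$; $T$ attains it if there is $x_0\in S_X$ with $\|Tx_0\|=\mu(T)$. The numerical range is $W(T)=\{x^*(Tx):x\in S_X,\ x^*\in S_{X^*},\ x^*(x)=1\}$ (so $W(T)=\{J(x)(Tx):x\in S_X\}$), and the Crawford number is $c(T)=\inf\{|\lambda|:\lambda\in W(T)\}$. $T$ attains its Crawford number if there is $x_0\in S_X$ with $|J(x_0)(Tx_0)|=c(T)$. *)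

(* Defs.v *)
(* The complex field is R[i] for R : realType. *)
From HB Require Import structures.
From mathcomp Require Import all_boot all_order all_algebra.
From mathcomp Require Import complex.
From mathcomp Require Import all_classical all_reals all_analysis.

Set Implicit Arguments.
Unset Strict Implicit.
Unset Printing Implicit Defensive.

Import Order.TTheory GRing.Theory Num.Theory.
Import numFieldNormedType.Exports.

Local Open Scope classical_set_scope.
Local Open Scope ring_scope.
Local Open Scope complex_scope.

Section BoundedLinear.
Context {K : numFieldType}.

Definition bounded_linear (V W : normedModType K) : {pred V -> W} :=
  fun f => `[< linear f /\ bounded_near f (nbhs (0 : V)) >].
Arguments bounded_linear V W f : clear implicits.

Record bdlin (V W : normedModType K) := BdLin {
  bdlin_fun :> V -> W;
  bdlin_prop : bdlin_fun \in bounded_linear V W }.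

HB.instance Definition _ (V W : normedModType K) :=
  [isSub for @bdlin_fun V W].
HB.instance Definition _ (V W : normedModType K) :=
  [Choice of bdlin V W by <:].

Fact bounded_linearP (V W : normedModType K) (f : V -> W) :
  f \in bounded_linear V W <-> linear f /\ continuous f.
Proof.
split=> [/asboolP[lf bf]|[lf cf]].
  pose g : {linear V -> W} := HB.pack f (GRing.isLinear.Build K V W *:%R f lf).
  by split=> //; exact: (@bounded_linear_continuous _ _ _ g bf).
pose g : {linear V -> W} := HB.pack f (GRing.isLinear.Build K V W *:%R f lf).
by apply/asboolP; split=> //; exact: (@continuous_linear_bounded _ _ _ 0 g (cf 0)).
Qed.

Fact bounded_linear_submod (V W : normedModType K) :
  submod_closed (bounded_linear V W).
Proof.
split=> [|a f g /bounded_linearP[lf cf] /bounded_linearP[lg cg]];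
  apply/bounded_linearP; split.
- by move=> k u v; rewrite -[LHS]/(0 : W) -[RHS]/(k *: 0 + 0 : W) scaler0 addr0.
- exact: cst_continuous.
- move=> k u v; rewrite -[LHS]/(a *: f _ + g _) -[RHS]/(k *: (_ *: f u + g u) + (_ *: f v + g v)).
  by rewrite lf lg !scalerDr !scalerA (mulrC a k) addrACA.
- by move=> x; apply: cvgD; [apply: cvgZr; exact: cf|exact: cg].
Qed.

HB.instance Definition _ (V W : normedModType K) :=
  GRing.isSubmodClosed.Build K (V -> W) (bounded_linear V W)
    (bounded_linear_submod V W).
HB.instance Definition _ (V W : normedModType K) :=
  [SubChoice_isSubLmodule of bdlin V W by <:].

Fact bdlin_linear (V W : normedModType K) (f : bdlin V W) : linear f.
Proof. exact: ((bounded_linearP f).1 (bdlin_prop f)).1. Qed.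

HB.instance Definition _ (V W : normedModType K) (f : bdlin V W) :=
  GRing.isLinear.Build K V W *:%R f (bdlin_linear f).

Fact bdlin_id_subproof (V : normedModType K) : idfun \in bounded_linear V V.
Proof. by apply/bounded_linearP; split=> // x; exact: cvg_id. Qed.

Definition bdlin_id (V : normedModType K) : bdlin V V :=
  BdLin (bdlin_id_subproof V).

Fact bdlin_comp_subproof (U V W : normedModType K)
  (f : bdlin V W) (g : bdlin U V) : f \o g \in bounded_linear U W.
Proof.
have [lf cf] := (bounded_linearP f).1 (bdlin_prop f).
have [lg cg] := (bounded_linearP g).1 (bdlin_prop g).
apply/bounded_linearP; split=> [k u v|x]; first by rewrite /= lg lf.
by apply: continuous_comp; [exact: cg|exact: cf].
Qed.

Definition bdlin_comp (U V W : normedModType K)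
    (f : bdlin V W) (g : bdlin U V) : bdlin U W :=
  BdLin (bdlin_comp_subproof f g).

End BoundedLinear.

Section NumericalRange.
Context {R : realType}.
Implicit Type X : normedModType R[i].

Definition dual X := bdlin X (R[i]^o).

(* Norms over R[i] take (real) values in R[i]; rnorm is the norm valued in R,
   where sup and inf are available. *)
Definition rnorm (V : normedZmodType R[i]) (x : V) : R := complex.Re `|x|.

Definition dual_norm X (f : dual X) : R :=
  sup [set rnorm (f x) | x in [set x : X | rnorm x <= 1]].

Definition sphere X : set X := [set x | rnorm x = 1].

Definition dual_sphere X : set (dual X) := [set f | dual_norm f = 1].

Definition smooth X : Prop :=
  forall x : X, sphere x -> exists! f : dual X, dual_sphere f /\ f x = 1.

(* Existence and uniqueness of the chosen functional hold when X is smooth;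
   xget returns its default value 0 when there is no such functional. *)
Definition duality_map X (x : X) : dual X :=
  xget 0 [set f : dual X | dual_norm f = rnorm x /\ f x = (rnorm x ^+ 2)%:C].

Definition transpose X (T : bdlin X X) : dual X -> dual X :=
  fun f => bdlin_comp f T.

Definition self_adjoint X (T : bdlin X X) : Prop :=
  transpose T \o @duality_map X = @duality_map X \o T.

Definition strongly_normal X (T : bdlin X X) : Prop :=
  exists S : bdlin X X, self_adjoint S /\ T = bdlin_comp S S.

(* On the zero space the sphere is empty and this infimum is 0 by the library
   convention; likewise for crawford_number. *)
Definition min_modulus X (T : bdlin X X) : R :=
  inf [set rnorm (T x) | x in @sphere X].

Definition attains_min_modulus X (T : bdlin X X) : Prop :=
  exists2 x0 : X, sphere x0 & rnorm (T x0) = min_modulus T.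

Definition numerical_range X (T : bdlin X X) : set R[i] :=
  [set z | exists (x : X) (f : dual X),
    [/\ sphere x, dual_sphere f, f x = 1 & z = f (T x)]].

Definition crawford_number X (T : bdlin X X) : R :=
  inf [set rnorm z | z in numerical_range T].

Definition attains_crawford_number X (T : bdlin X X) : Prop :=
  exists2 x0 : X, sphere x0 &
    rnorm (duality_map x0 (T x0)) = crawford_number T.

Definition is_eigenvalue X (T : bdlin X X) (a : R[i]) : Prop :=
  exists2 x : X, x != 0 & T x = a *: x.

End NumericalRange.

(* Main.v *)
Require Import Defs.
From HB Require Import structures.
From mathcomp Require Import all_boot all_order all_algebra.
From mathcomp Require Import complex.
From mathcomp Require Import all_classical all_reals all_analysis.

(** Write [c] for the Crawford number of [T], [mu] for its minimum modulus and
    [J] for the duality map, and let [S] be a self-adjoint operator with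
    [T - c I = S^2].  Self-adjointness moves one factor [S] across [J]:
      [J(x)(S^2 x) = J(S x)(S x) = |S x|^2],
    so on the unit sphere [J(x)(T x) = c + |S x|^2]
    ([duality_map_shifted_square]).  The numerical range therefore lies on the
    real half-line above [c], and [|S x|] measures how far [x] is from attaining
    the Crawford number.

    Two things follow.  As [c] is the infimum of [c + |S x|^2], there are unit
    vectors with [|S x|] arbitrarily small; along them [T x] is close to [c x],
    which gives [mu <= c], while [|J(x)(T x)| <= |T x|] gives [c <= mu]
    ([min_modulus_eq_crawford]).  And a unit vector attains [c] exactly when
    [S x = 0], in which case [T x = c x = mu x].  Conversely a unit eigenvector
    for [mu] clearly attains [mu], and a unit vector attaining [mu] satisfies
    [c <= |J(x)(T x)| <= |T x| = mu = c], so it attains [c]. *)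

Set Implicit Arguments.
Unset Strict Implicit.
Unset Printing Implicit Defensive.

Import Order.TTheory GRing.Theory Num.Theory.
Import numFieldNormedType.Exports.
Local Open Scope ring_scope.
Local Open Scope complex_scope.

(** * Real-valued norms *)

Lemma rnormE (R : realType) (V : normedZmodType R[i]) (x : V) :
  (rnorm x)%:C = `|x|.
Proof. by rewrite /rnorm RRe_real ?normr_real. Qed.

Lemma rnorm_ge0 (R : realType) (V : normedZmodType R[i]) (x : V) :
  0 <= rnorm x.
Proof. by rewrite -lecR rnormE normr_ge0. Qed.

Lemma rnorm0_eq0 (R : realType) (V : normedZmodType R[i]) (x : V) :
  rnorm x = 0 -> x = 0.
Proof. by move=> x0; apply/normr0_eq0; rewrite -rnormE x0. Qed.

Lemma rnorm0 (R : realType) (V : normedZmodType R[i]) : rnorm (0 : V) = 0.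
Proof. by rewrite /rnorm normr0. Qed.

Lemma rnormD (R : realType) (V : normedZmodType R[i]) (x y : V) :
  rnorm (x + y) <= rnorm x + rnorm y.
Proof. by rewrite -lecR rmorphD /= !rnormE ler_normD. Qed.

Lemma rnorm_real (R : realType) (a : R) : 0 <= a -> rnorm (a%:C : R[i]) = a.
Proof. by move=> a0; rewrite /rnorm ger0_norm ?lecR. Qed.

Lemma rnormZ (R : realType) (V : normedModType R[i]) (a : R) (x : V) :
  0 <= a -> rnorm (a%:C *: x) = a * rnorm x.
Proof.
move=> a0; apply: (@complexI R).
by rewrite rmorphM /= !rnormE normrZ ger0_norm ?lecR.
Qed.

Lemma rnorm_normalize (R : realType) (V : normedModType R[i]) (x : V) :
  x != 0 -> rnorm ((rnorm x)^-1%:C *: x) = 1.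
Proof.
move=> x0; rewrite rnormZ ?invr_ge0 ?rnorm_ge0// mulVf//.
by apply: contra_neq x0; exact: rnorm0_eq0.
Qed.

(** * Operator bounds and the dual norm *)

Lemma bdlin_bound (R : realType) (V W : normedModType R[i]) (f : bdlin V W) :
  exists2 M : R, 0 < M & forall x, rnorm (f x) <= M * rnorm x.
Proof.
have /asboolP[_ /linear_boundedP/pinfty_ex_gt0[M M0 fM]] := bdlin_prop f.
have ME : (complex.Re M)%:C = M by rewrite RRe_real ?gtr0_real.
exists (complex.Re M) => [|x]; first by rewrite -ltcR ME.
by rewrite -lecR rmorphM /= !rnormE ME fM.
Qed.

Lemma dual_norm_le (R : realType) (X : normedModType R[i]) (f : dual X) (a : R) :
  (forall x, rnorm x <= 1 -> rnorm (f x) <= a) -> dual_norm f <= a.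
Proof.
move=> fa; apply: ge_sup => [|_ [x x1 <-]]; last exact: fa.
by exists (rnorm (f 0)); exists 0; rewrite //= rnorm0.
Qed.

(** Boundedness of [f] is what makes the supremum [dual_norm f] an upper
    bound: the supremum of an unbounded set is [0] by convention. *)
Lemma rnorm_le_dual_norm (R : realType) (X : normedModType R[i]) (f : dual X)
  (x : X) : rnorm (f x) <= dual_norm f * rnorm x.
Proof.
have [->|x0] := eqVneq x 0; first by rewrite linear0 !rnorm0 mulr0.
have x_gt0 : 0 < rnorm x.
  rewrite lt_def rnorm_ge0 andbT.
  by apply: contra_neq x0; exact: rnorm0_eq0.
have [M M0 fM] := bdlin_bound f.
rewrite -ler_pdivrMr// mulrC -rnormZ ?invr_ge0 ?rnorm_ge0// -linearZ.
apply: ub_le_sup; last first.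
  by exists ((rnorm x)^-1%:C *: x); rewrite //= rnorm_normalize.
exists M => _ [y y1 <-]; rewrite (le_trans (fM y))//.
by rewrite -[leRHS]mulr1 ler_pM2l.
Qed.

(** * The duality map of a smooth space *)

(** A support functional of the normalisation of [x], scaled by [|x|], is a
    functional with the two properties that define [duality_map x]: its norm is
    at most [|x|] by homogeneity, and at least [|x|] because its value at [x]
    is [|x|^2]. *)
Lemma duality_mapP (R : realType) (X : normedModType R[i]) (x : X) :
  smooth X ->
  dual_norm (duality_map x) = rnorm x /\
  duality_map x x = (rnorm x ^+ 2)%:C.
Proof.
move=> smoothX; rewrite /duality_map.
apply: (@xgetPex _ 0 [set f : dual X | dual_norm f = rnorm x /\
  f x = (rnorm x ^+ 2)%:C]%classic) => /=.
have [->|x0] := eqVneq x 0.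
  exists 0; split; last by rewrite linear0 rnorm0 expr0n.
  rewrite rnorm0 -[RHS]sup1; congr sup; apply/seteqP.
  split=> [_ [y _ <-]|_ ->]; first exact: rnorm0.
  by exists 0; rewrite //= ?rnorm0 ?ler01.
have [f [[f1 fx] _]] := smoothX _ (rnorm_normalize x0).
have r0 : rnorm x != 0 by apply: contra_neq x0; exact: rnorm0_eq0.
have r_gt0 : 0 < rnorm x by rewrite lt_def r0 rnorm_ge0.
pose g : dual X := (rnorm x)%:C *: f.
have gE y : g y = (rnorm x)%:C *: f y by [].
have gx : g x = (rnorm x ^+ 2)%:C.
  have xE : x = (rnorm x)%:C *: ((rnorm x)^-1%:C *: x).
    by rewrite scalerA -rmorphM /= divff// scale1r.
  by rewrite gE [X in f X]xE linearZ /= fx scalerA -rmorphM -expr2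
    /GRing.scale /= mulr1.
exists g; split => //; apply/eqP; rewrite eq_le; apply/andP; split.
  apply: dual_norm_le => y y1; rewrite gE rnormZ ?rnorm_ge0//.
  rewrite -[leRHS]mulr1 ler_pM2l// (le_trans (rnorm_le_dual_norm f y))//.
  by rewrite f1 mul1r.
rewrite -(ler_pM2r r_gt0) -expr2.
have := rnorm_le_dual_norm g x.
by rewrite gx rnorm_real// sqr_ge0.
Qed.

Lemma rnorm_duality_map_le (R : realType) (X : normedModType R[i]) (x y : X) :
  smooth X -> rnorm (duality_map x y) <= rnorm x * rnorm y.
Proof.
by move=> /(duality_mapP x)[<- _]; exact: rnorm_le_dual_norm.
Qed.

(** Smoothness leaves [duality_map x] as the only support functional at a unit
    vector [x]. *)
Lemma numerical_rangeP (R : realType) (X : normedModType R[i])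
    (T : bdlin X X) (z : R[i]) : smooth X ->
  numerical_range T z <-> exists2 x, sphere x & z = duality_map x (T x).
Proof.
move=> smoothX.
have Jx (x : X) : sphere x -> dual_sphere (duality_map x) /\ duality_map x x = 1.
  by move=> x1; have [+ ->] := duality_mapP x smoothX; rewrite x1 expr1n.
split=> [[x [f [x1 f1 fx ->]]]|[x x1 ->]].
  exists x => //; have [g [_ guniq]] := smoothX _ x1.
  by rewrite -(guniq _ (conj f1 fx)) -(guniq _ (Jx _ x1)).
by exists x, (duality_map x); have [? ?] := Jx _ x1.
Qed.

(** * Minimum modulus and Crawford number *)

Lemma min_modulus_le (R : realType) (X : normedModType R[i]) (T : bdlin X X)
  (x : X) : sphere x -> min_modulus T <= rnorm (T x).
Proof.
move=> x1; apply: ge_inf; last by exists x.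
by exists 0 => _ [y _ <-]; exact: rnorm_ge0.
Qed.

Lemma crawford_le (R : realType) (X : normedModType R[i]) (T : bdlin X X)
    (x : X) : smooth X -> sphere x ->
  crawford_number T <= rnorm (duality_map x (T x)).
Proof.
move=> smoothX x1; apply: ge_inf.
  by exists 0 => _ [z _ <-]; exact: rnorm_ge0.
by exists (duality_map x (T x)) => //; apply/numerical_rangeP => //; exists x.
Qed.

Lemma crawford_ge0 (R : realType) (X : normedModType R[i]) (T : bdlin X X) :
  0 <= crawford_number T.
Proof.
rewrite /crawford_number.
have [->|/set0P ne] := eqVneq [set rnorm z | z in numerical_range T]%classic set0.
  by rewrite inf0.
by apply: lb_le_inf => // _ [z _ <-]; exact: rnorm_ge0.
Qed.

Lemma crawford_le_rnorm (R : realType) (X : normedModType R[i])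
    (T : bdlin X X) (x : X) : smooth X -> sphere x ->
  crawford_number T <= rnorm (T x).
Proof.
move=> smoothX x1; apply: le_trans (crawford_le T smoothX x1) _.
by rewrite (le_trans (rnorm_duality_map_le _ _ smoothX))// x1 mul1r.
Qed.

Lemma crawford_lt (R : realType) (X : normedModType R[i]) (T : bdlin X X)
    (x : X) (a : R) : smooth X -> sphere x -> crawford_number T < a ->
  exists2 y, sphere y & rnorm (duality_map y (T y)) < a.
Proof.
move=> smoothX x1 /inf_lt[|_ [z + <-]].
  exists (rnorm (duality_map x (T x))), (duality_map x (T x)) => //.
  by apply/numerical_rangeP => //; exists x.
by move=> /(numerical_rangeP _ _ smoothX)[y y1 ->] ya; exists y.
Qed.

(** * Shifts of squares of self-adjoint operators *)

(** Self-adjointness at [x] reads [J(x)(S y) = J(S x)(y)]; take [y = S x]. *)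
Lemma duality_map_shifted_square (R : realType) (X : normedModType R[i])
    (S : bdlin X X) (c : R) (x : X) : smooth X -> self_adjoint S -> sphere x ->
  duality_map x (c%:C *: x + S (S x)) = (c + rnorm (S x) ^+ 2)%:C.
Proof.
move=> smoothX Ssa x1; rewrite linearD linearZ rmorphD /=.
have [_ ->] := duality_mapP x smoothX; rewrite x1 expr1n.
have [_ <-] := duality_mapP (S x) smoothX.
have SJ : transpose S (duality_map x) = duality_map (S x) := congr1 (@^~ x) Ssa.
by rewrite -SJ /GRing.scale /= mulr1.
Qed.

Lemma rnorm_crawford_shifted_square (R : realType) (X : normedModType R[i])
    (T S : bdlin X X) (x : X) : smooth X -> self_adjoint S ->
  (forall y, T y = (crawford_number T)%:C *: y + S (S y)) -> sphere x ->
  rnorm (duality_map x (T x)) = crawford_number T + rnorm (S x) ^+ 2.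
Proof.
move=> smoothX Ssa TE x1; rewrite TE duality_map_shifted_square//.
by rewrite rnorm_real// addr_ge0 ?crawford_ge0 ?sqr_ge0.
Qed.

(** The inequality [mu <= c] holds because [c] is approached by unit vectors [y]
    with [S y] small, at which [T y - c y = S (S y)] is small as well. *)
Lemma min_modulus_eq_crawford (R : realType) (X : normedModType R[i])
    (T S : bdlin X X) (x : X) : smooth X -> self_adjoint S ->
  (forall y, T y = (crawford_number T)%:C *: y + S (S y)) -> sphere x ->
  min_modulus T = crawford_number T.
Proof.
move=> smoothX Ssa TE x1; apply/eqP; rewrite eq_le; apply/andP; split; last first.
  apply: lb_le_inf => [|_ [y y1 <-]]; first by exists (rnorm (T x)), x.
  exact: crawford_le_rnorm.
have [M M0 SM] := bdlin_bound S.
apply/ler_addgt0Pr => e e0.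
(* [|T y| <= c + M |S y|], so [|S y| < e / M] is the closeness needed. *)
have d0 : 0 < e / M by rewrite divr_gt0.
have cd : crawford_number T < crawford_number T + (e / M) ^+ 2.
  by rewrite ltrDl exprn_gt0.
have [y y1] := crawford_lt smoothX x1 cd.
rewrite (rnorm_crawford_shifted_square smoothX Ssa TE y1) ltrD2l.
rewrite ltr_pXn2r// ?nnegrE ?rnorm_ge0 ?(ltW d0)// ltr_pdivlMr// => yd.
rewrite (le_trans (min_modulus_le T y1))// TE (le_trans (rnormD _ _))//.
rewrite rnormZ ?crawford_ge0// y1 mulr1 lerD2l (le_trans (SM _))//.
by rewrite mulrC ltW.
Qed.

Theorem proposition7 (R : realType) (X : completeNormedModType R[i])
    (smoothX : smooth X) (T : bdlin X X)
    (hT : strongly_normal (T - (crawford_number T)%:C *: bdlin_id X))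
    (hT2 : strongly_normal
             (bdlin_comp T T - (crawford_number T ^+ 2)%:C *: bdlin_id X)) :
  (attains_min_modulus T <-> attains_crawford_number T) /\
  (attains_crawford_number T <-> is_eigenvalue T (min_modulus T)%:C).
Proof.
have [S [Ssa TS]] := hT.
have TE y : T y = (crawford_number T)%:C *: y + S (S y).
  have /eqP : T y - (crawford_number T)%:C *: y = S (S y).
    by have := congr1 (fun f : bdlin X X => f y) TS.
  by rewrite subr_eq addrC => /eqP.
have min_crawford :
    attains_min_modulus T -> attains_crawford_number T.
  move=> [x x1 Tx]; exists x => //; apply/eqP.
  rewrite eq_le crawford_le// andbT.
  rewrite (le_trans (rnorm_duality_map_le _ _ smoothX))// x1 mul1r Tx.
  by rewrite (min_modulus_eq_crawford smoothX Ssa TE x1).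
have crawford_eigen :
    attains_crawford_number T -> is_eigenvalue T (min_modulus T)%:C.
  move=> [x x1]; rewrite (rnorm_crawford_shifted_square smoothX Ssa TE x1).
  rewrite -[RHS]addr0 => /addrI/eqP; rewrite sqrf_eq0 => /eqP/rnorm0_eq0 Sx.
  exists x; last first.
    by rewrite (min_modulus_eq_crawford smoothX Ssa TE x1) TE Sx linear0 addr0.
  apply/eqP => x0; move: x1; rewrite x0 /sphere /= rnorm0 => /esym/eqP.
  by rewrite oner_eq0.
have eigen_min :
    is_eigenvalue T (min_modulus T)%:C -> attains_min_modulus T.
  move=> [x x0 Tx]; have x1 := rnorm_normalize x0.
  exists ((rnorm x)^-1%:C *: x) => //.
  rewrite linearZ /= Tx scalerA mulrC -scalerA rnormZ ?x1 ?mulr1//.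
  by rewrite (min_modulus_eq_crawford smoothX Ssa TE x1) crawford_ge0.
by split; split; auto.
Qed.
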